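(* Let $n\ge 1$ and $d\ge 3$ be integers. If $B$ is a solution in $[n]^d$, then each of its $d$ orthogonal projections contains at least $\frac{1}{d}n^{d-1}+\frac{d-1}{d}n^{d-2}$ hypercubes of dimension $d-1$ (i.e. at least that many elements of $[n]^{d-1}$).
   Context: $[n]^d$ denotes the graph whose vertices (also called cubes) are the $d$-tuples $(x_1,\dots,x_d)$ with $x_i\in\{1,\dots,n\}$; two vertices are neighbours if they differ in exactly one coordinate, and in that coordinate by exactly $1$. A position is any subset of the vertices of $[n]^d$. A dismantling move removes from the current position a vertex having exactly $d$ neighbours in the current position. A base position is a set of $n^{d-1}$ pairwise non-neighbouring vertices of $[n]^d$. A solution is a base position that can be obtained from the full position $[n]^d$ by a finite sequence of dismantling moves. An orthogonal projection of a set of vertices of $[n]^d$ is its image in $[n]^{d-1}$ under the map omitting one specific coordinate; elements of $[n]^{d-1}$ are identified with unit hypercubes of dimension $d-1$. *)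

(* Defs.v *)
From mathcomp Require Export all_boot all_order all_algebra.

Set Implicit Arguments.
Unset Strict Implicit.
Unset Printing Implicit Defensive.

(* Vertices of [n]^d; coordinates range over {0, ..., n-1} rather than
   {1, ..., n}. *)
Definition cube (n d : nat) := {ffun 'I_d -> 'I_n}.

Definition neighbour (n d : nat) : rel (cube n d) := fun x y =>
  [exists i : 'I_d,
    ((val (x i) == (val (y i)).+1) || (val (y i) == (val (x i)).+1))
    && [forall j : 'I_d, (j != i) ==> (x j == y j)]].

Definition dismantling_move (n d : nat) : rel {set cube n d} := fun P Q =>
  [exists x in P,
    (#|[set y in P | neighbour x y]| == d) && (Q == P :\ x)].

Definition base_position (n d : nat) (B : {set cube n d}) : bool :=
  (#|B| == n ^ (d - 1)) &&
  [forall x in B, forall y in B, ~~ neighbour x y].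

Definition solution (n d : nat) (B : {set cube n d}) : bool :=
  base_position B && connect (@dismantling_move n d) [set: cube n d] B.

(* [lift k] enumerates increasingly the elements of 'I_d other than k, so this
   deletes the coordinate k. *)
Definition omit_coord (n d : nat) (k : 'I_d) (x : cube n d) : cube n d.-1 :=
  [ffun j => x (lift k j)].

Definition projection (n d : nat) (k : 'I_d) (B : {set cube n d}) :
    {set cube n d.-1} :=
  [set omit_coord k x | x in B].

(* Main.v *)
(* Project onto [n]^(d-1) along coordinate k.  When the last cube of a line
   parallel to k is dismantled, its d neighbours lie on d distinct adjacent lines
   that are still nonempty, so at that moment the projection loses a vertex having
   at least d neighbours in it.  As [n]^(d-1) has (d-1)(n-1)n^(d-2) edges, at
   most (d-1)(n-1)n^(d-2)/d vertices are lost. *)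
Require Import Defs.
From mathcomp Require Import all_boot all_order all_algebra.
From mathcomp Require Import zify ring.

Set Implicit Arguments.
Unset Strict Implicit.
Unset Printing Implicit Defensive.

Import Order.TTheory GRing.Theory Num.Theory.
Local Open Scope ring_scope.

(** For symmetric irreflexive [e] this is twice the number of edges of the graph induced on [Q];
    ordered pairs avoid a division by 2. *)
Definition arcs (T : finType) (e : rel T) (Q : {set T}) : nat :=
  (\sum_(x in Q) #|[set y in Q | e x y]|)%N.

(** Each edge at [v] is counted once in the term of [v] and once in the term of its other end, which
    differs from [v] by irreflexivity. *)
Lemma arcsD1 (T : finType) (e : rel T) (Q : {set T}) (v : T) :
  symmetric e -> irreflexive e -> v \in Q ->
  arcs e Q = (arcs e (Q :\ v) + 2 * #|[set y in Q | e v y]|)%N.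
Proof.
move=> esym eirr vQ; rewrite /arcs (big_setD1 v) //=.
have -> : (\sum_(x in Q :\ v) #|[set y in Q | e x y]| =
           \sum_(x in Q :\ v) (e x v + #|[set y in Q :\ v | e x y]|))%N.
  apply: eq_bigr => x _; rewrite (cardsD1 v) inE vQ /=; congr (_ + #|pred_of_set _|)%N.
  by apply/setP=> y; rewrite !inE andbA.
rewrite big_split /=.
suff -> : (\sum_(x in Q :\ v) e x v = #|[set y in Q | e v y]|)%N by lia.
rewrite -big_mkcondr sum1_card /=; apply: eq_card => y; rewrite !inE.
by rewrite unfold_in /= !inE esym; case: eqP => [->|]; rewrite ?eirr ?andbF.
Qed.

Lemma neighbour_sym n d : symmetric (@neighbour n d).
Proof.
move=> x y; rewrite /neighbour; apply: eq_existsb => i.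
by rewrite orbC; congr (_ && _); apply: eq_forallb => j; rewrite (eq_sym (x j)).
Qed.

Lemma neighbour_irr n d : irreflexive (@neighbour n d).
Proof. by move=> x; apply/existsP=> -[i /andP[+ _]]; lia. Qed.

Lemma neighbourP n d (x y : cube n d) :
  reflect (exists2 i, val (x i) = (val (y i)).+1 \/ val (y i) = (val (x i)).+1
                    & forall j, j != i -> x j = y j)
          (neighbour x y).
Proof.
apply: (iffP existsP) => [[i /andP[xyi /forallP xyj]]|[i xyi xyj]]; exists i.
- by case/orP: xyi => /eqP; [left | right].
- by move=> j ji; apply/eqP; exact: (implyP (xyj j)).
- apply/andP; split; first by case: xyi => ->; rewrite eqxx ?orbT.
  by apply/forallP => j; apply/implyP => /xyj ->.
Qed.

Lemma omit_coord_inj n d (k : 'I_d) (x y : cube n d) :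
  x k = y k -> omit_coord k x = omit_coord k y -> x = y.
Proof.
move=> xyk /ffunP xy; apply/ffunP=> j.
by case: (unliftP k j) => [i ->|-> //]; have := xy i; rewrite !ffunE.
Qed.

(** The coordinate in which [x] and [y] differ cannot be [k], for then the projections would
    coincide; hence it survives the projection. *)
Lemma neighbour_omit_coord n d (k : 'I_d) (x y : cube n d) :
  neighbour x y -> omit_coord k y != omit_coord k x ->
  x k = y k /\ neighbour (omit_coord k x) (omit_coord k y).
Proof.
case/neighbourP=> i xyi xyj.
case: (unliftP k i) xyi xyj => [i' ->|->] xyi xyj.
- move=> _; split; first by apply: xyj; exact: neq_lift.
  apply/neighbourP; exists i'; first by rewrite !ffunE.
  by move=> j ji; rewrite !ffunE; apply: xyj; rewrite (inj_eq lift_inj).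
- case/eqP; apply/ffunP => j; rewrite !ffunE; symmetry; apply: xyj.
  by rewrite eq_sym neq_lift.
Qed.

Lemma projection_move n d (k : 'I_d) (P Q : {set cube n d}) :
  dismantling_move P Q ->
  projection k Q = projection k P \/
  exists v, [/\ v \in projection k P, projection k Q = projection k P :\ v &
    (d <= #|[set w in projection k P | neighbour v w]|)%N].
Proof.
case/existsP=> x /andP[xP /andP[/eqP degx /eqP ->]].
set v := omit_coord k x.
have projP : projection k P = v |: projection k (P :\ x).
  by rewrite /projection -imsetU1 setD1K.
have [vQ|vQ] := boolP (v \in projection k (P :\ x)).
  by left; rewrite projP; apply/setP=> w; rewrite !inE; case: eqP => // ->; rewrite vQ.
right; exists v; split; first by rewrite projP setU11.
  by rewrite projP setU1K.
(* A neighbour of [x] on the same line would keep [v] in the projection, against [vQ]. *)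
have nbr y : y \in [set y in P | neighbour x y] ->
    x k = y k /\ neighbour v (omit_coord k y).
  rewrite inE => /andP[yP xy]; apply: neighbour_omit_coord => //.
  apply: contraNneq vQ => yv; rewrite /v -yv; apply: imset_f.
  by rewrite !inE yP andbT; apply: contraTneq xy => ->; rewrite neighbour_irr.
rewrite -[X in (X <= _)%N]degx.
(* All neighbours of [x] in [P] share its coordinate [k], so their projections are distinct. *)
rewrite -(@card_in_imset _ _ (@omit_coord n d k)); last first.
  by move=> y z /nbr[xy _] /nbr[xz _]; apply: omit_coord_inj; rewrite -xy.
apply: subset_leq_card; apply/subsetP => _ /imsetP[y yN ->].
have [_ vy] := nbr y yN; rewrite inE vy andbT; apply: imset_f.
by move: yN; rewrite inE => /andP[].
Qed.

(** The potential [arcs] minus [2 * d] times the cardinality of the projection never increases: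
    losing a vertex removes at least [2 * d] arcs. The additive form avoids truncated
    subtraction. *)
Lemma arcs_projection n d (k : 'I_d) (P Q : {set cube n d}) :
  connect (@dismantling_move n d) P Q ->
  (arcs (@neighbour n d.-1) (projection k Q) + 2 * d * #|projection k P|
   <= arcs (@neighbour n d.-1) (projection k P) + 2 * d * #|projection k Q|)%N.
Proof.
case/connectP=> s + ->; elim: s P => //= R s IH P /andP[PR /IH {}IH].
case: (projection_move k PR) => [<- //|[v [vP projR dv]]].
rewrite (arcsD1 (@neighbour_sym _ _) (@neighbour_irr _ _) vP).
rewrite (cardsD1 v (projection k P)) vP -projR.
have arith a b c p q : (a + 2 * d * p <= b + 2 * d * q -> d <= c ->
    a + 2 * d * (1 + p) <= b + 2 * c + 2 * d * q)%N by nia.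
exact: arith IH dv.
Qed.

Lemma card_coord_neq n m (c : 'I_n) (i : 'I_m.+1) :
  #|[set x : cube n m.+1 | x i != c]| = (n.-1 * n ^ m)%N.
Proof.
pose F (j : 'I_m.+1) : pred 'I_n := if j == i then predC1 c else predT.
have -> : #|[set x : cube n m.+1 | x i != c]| = #|family F|.
  apply: eq_card => x; rewrite inE; apply/idP/familyP => [xi j|/(_ i)].
    by rewrite /F; case: eqP => [->|].
  by rewrite /F eqxx.
rewrite card_family foldrE big_image /= (bigD1 i) //=.
rewrite /F eqxx cardC1 card_ord; congr (_ * _)%N.
rewrite (eq_bigr (fun=> n)) => [|j /negbTE->]; last by rewrite card_ord.
by rewrite prod_nat_const cardC1 card_ord.
Qed.

(** An edge in direction [i] is determined by its upper end, whose coordinate [i] is nonzero; this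
    leaves at most [n.-1 * n ^ m] edges in each of the [m.+1] directions, each giving two arcs. *)
Lemma arcs_cube_le n m :
  (arcs (@neighbour n m.+1) setT <= 2 * (m.+1 * (n.-1 * n ^ m)))%N.
Proof.
case: n => [|n].
  by rewrite /arcs big1 // => x; case: (x ord0) => [].
pose succ i (x y : cube n.+1 m.+1) :=
  (val (y i) == (val (x i)).+1) && [forall j, (j != i) ==> (x j == y j)].
have succ_le i : (\sum_x \sum_y succ i x y <= n * n.+1 ^ m)%N.
  (* Sum over the upper end [y] first: it has at most one lower end [x], and none when [y i] is
     0. *)
  rewrite exchange_big /= -(card_coord_neq ord0 i) -sum1_card [leqRHS]big_mkcond /=.
  apply: leq_sum => y _; rewrite inE.
  have -> : (\sum_x succ i x y = #|[set x | succ i x y]|)%N.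
    by rewrite -big_mkcond sum1dep_card.
  have [yi|yi] := eqVneq (y i) ord0.
    by rewrite leqn0 cards_eq0; apply/eqP/setP => x; rewrite !inE /succ yi.
  apply/card_le1_eqP => x x'; rewrite !inE.
  move=> /andP[/eqP yx /forallP xy] /andP[/eqP yx' /forallP x'y].
  apply/ffunP => j; have [->|ji] := eqVneq j i.
    by apply: val_inj; apply: succn_inj; rewrite -yx.
  by rewrite (eqP (implyP (xy j) ji)) (eqP (implyP (x'y j) ji)).
have nbr_le x y : (neighbour x y <= \sum_i (succ i x y + succ i y x))%N.
  have [/existsP[i /andP[xyi xyj]]|] := boolP (neighbour x y); last by [].
  rewrite (bigD1 i) /= // /succ.
  have -> : [forall j, (j != i) ==> (y j == x j)].
    by apply/forallP => j; rewrite (eq_sym (y j)); exact: (forallP xyj).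
  by rewrite xyj !andbT; case/orP: xyi => ->; lia.
have -> : arcs (@neighbour n.+1 m.+1) setT = (\sum_x \sum_y @neighbour n.+1 m.+1 x y)%N.
  rewrite /arcs big_mkcond; apply: eq_bigr => x _; rewrite inE.
  by rewrite -big_mkcond sum1dep_card; apply: eq_card => y; rewrite !inE.
apply: (@leq_trans (\sum_i \sum_x \sum_y (succ i x y + succ i y x)))%N.
  rewrite [leqRHS]exchange_big; apply: leq_sum => x _.
  by rewrite [leqRHS]exchange_big; apply: leq_sum => y _.
apply: (@leq_trans (\sum_(i < m.+1) 2 * (n * n.+1 ^ m)))%N; last first.
  by rewrite sum_nat_const card_ord; lia.
apply: leq_sum => i _.
rewrite (eq_bigr (fun x => \sum_y succ i x y + \sum_y succ i y x)%N); last first.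
  by move=> x _; rewrite big_split.
rewrite big_split /= [X in (_ + X <= _)%N]exchange_big /=.
by rewrite mul2n -addnn; exact: leq_add (succ_le i) (succ_le i).
Qed.

Lemma projection_setT n d (k : 'I_d) :
  (0 < n)%N -> projection k [set: cube n d] = setT.
Proof.
case: n => // n _; apply/setP=> w; rewrite inE; apply/imsetP.
(* The preimage of [w] gets the arbitrary value [ord0] in the omitted coordinate [k]. *)
exists [ffun j => if unlift k j is Some j' then w j' else ord0]; rewrite ?inE //.
by apply/ffunP=> j; rewrite !ffunE liftK.
Qed.

Theorem proposition4 (n d : nat) (hn : (1 <= n)%N) (hd : (3 <= d)%N)
    (B : {set cube n d}) (hB : solution B) (k : 'I_d) :
  1 / d%:R * n%:R ^+ (d - 1) + (d%:R - 1) / d%:R * n%:R ^+ (d - 2)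
    <= (#|projection k B|%:R : rat).
Proof.
case/andP: hB => _ /(arcs_projection k).
rewrite projection_setT // cardsT card_ffun !card_ord.
case: d hd B k => [|[|m]] // _ B k /=.
have := arcs_cube_le n m; case: n hn B => // n _ B.
set p := #|_|; rewrite /= !subSS !subn0 expnS.
set N := (n.+1 ^ m)%N => arcs_le proj_le.
(* The claim multiplied by the dimension [m.+2], with side [n.+1]. It follows on dropping the arcs
   left in the projection of [B], since [m.+2 * n.+1 * N - m.+1 * n * N] equals the left-hand
   side. *)
have : (n.+1 * N + m.+1 * N <= m.+2 * p)%N.
  have := leq_trans (leq_trans (leq_addl _ _) proj_le) (leq_add arcs_le (leqnn _)).
  by rewrite -/p; nia.
rewrite -(ler_nat rat) !(natrD, natrM) => bound.
have d_gt0 : 0 < m.+2%:R :> rat by rewrite ltr0n.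
rewrite exprS -natrX -/N -(ler_pM2l d_gt0); apply: le_trans bound.
rewrite [leLHS](_ : _ = n.+1%:R * N%:R + (m.+2%:R - 1) * N%:R); last first.
  by field; rewrite -natrD pnatr_eq0.
by rewrite -[m.+2%:R]natr1 addrK.
Qed.
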